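(* Let $Ax^2+Bx$ be an integer valued polynomial with $A>B\ge 0$, let $k\ge 1$ be an integer, and let $Y=\{y_1,y_2,y_3,y_4\}$ be a set of four pairwise coprime positive integers. Let $H_1,H_2,\ldots,H_8$ be the explicit real polynomials in the variable $l$ (with coefficients depending on $A,B,k,y_1,y_2,y_3,y_4$) given in the context, and put $$L_{Y,A,B}^k=\lceil \mathcal{T}_l\{H_1,H_2,\ldots,H_8\}\rceil .$$ Then $\gamma_{Y,A,B}^k(n)\ge 0$ for all integers $$n\ge N_{Y,A,B}^k=A\left(k+2L_{Y,A,B}^k\right)^2+B\left(k+2L_{Y,A,B}^k\right).$$
   Context: For a finite set $S$ of pairwise coprime positive integers, an integer valued polynomial $Ax^2+Bx$ (i.e. taking integer values at integers) with real $A>B\ge 0$, and integers $k\ge 1$, $n\ge 0$, the coefficients $\gamma_{S,A,B}^k(n)$ are defined by the formal power series identity $$\prod_{s\in S}\frac{1}{1-q^s}\sum_{j\not\in[-k,k-1]}(-1)^{j+k}q^{Aj^2+Bj}=\sum_{n=0}^{\infty}\gamma_{S,A,B}^k(n)q^n,$$ where the sum is over all integers $j\le -k-1$ and $j\ge k$. For a real polynomial $G(x)$, $\mathcal{R}_xG(x)$ is the set of all real roots of $G(x)$. For real polynomials $G_1(x),\ldots,G_m(x)$, $$\mathcal{T}_x\{G_1(x),\ldots,G_m(x)\}=\max\left(\{1\}\cup\mathcal{R}_xG_1(x)\cup\cdots\cup\mathcal{R}_xG_m(x)\right).$$ $\lceil x\rceil$ is the smallest integer $\ge x$. Constants: $$a=\frac{1}{6y_1y_2y_3y_4},\qquad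 b=\frac{y_1+y_2+y_3+y_4}{4y_1y_2y_3y_4},$$ $$c=\frac{y_1^2+y_2^2+y_3^2+y_4^2+3(y_1y_2+y_1y_3+y_1y_4+y_2y_3+y_2y_4+y_3y_4)}{12y_1y_2y_3y_4},$$ and $e=D_{y_1,y_2,y_3,y_4}$, defined as follows. Let $s(n)$ ($n\ge 0$) be defined by $$\frac{1}{(1-q^{y_1})(1-q^{y_2})(1-q^{y_3})(1-q^{y_4})}=\sum_{n\ge 0}(an^3+bn^2+cn)q^n+\sum_{n\ge 0}s(n)q^n;$$ it is known that $s(n)$ is periodic in $n$ with period $y_1y_2y_3y_4$, and $D_{y_1,y_2,y_3,y_4}$ is the smallest real number with $|s(n)|\le D_{y_1,y_2,y_3,y_4}$ for all integers $n\ge 0$. The polynomials in $l$: \begin{align*} H_1=&12a(A-B)(2Ak-A-B)l^2+6a(2k+1)(A-B)(2Ak-A-B)l+\frac{3ac-b^2}{3a},\\ H_2=&48A^2ak(A-B)l^4+16a(A-B)(6A^2k^2+3ABk+A^2+AB-2B^2)l^3\\ &+4(A-B)(12A^2ak^3+18ABak^2+9A^2ak+9ABak-9B^2ak-3ABa+2Abk-3B^2a\\ &-2Bb)l^2+(24A^2Bak^3-24AB^2ak^3+24A^3ak^2-36AB^2ak^2+12B^3ak^2-6A^2Bak\\ &+8A^2bk^2-8ABbk^2+6B^3ak-6A^3a+6AB^2a-4ABbk+4B^2bk-2A^2b+2B^2b-2Ac\\ &+2Bc-4e)l-e,\\ H_3=&48A^2ak(A-B)l^4+8a(A-B)(9A^2k^2+12A^2k-2A^2-2BA+B^2)l^3\\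 &+12a(A-B)(2A^2k^3+9A^2k^2+4A^2k-2ABk+B^2k-2A^2-2BA+B^2)l^2\\ &+((144A^3a^2k^3-144A^2Ba^2k^3+252A^3a^2k^2-324A^2Ba^2k^2+108AB^2a^2k^2-36B^3a^2k^2\\ &-144A^2Ba^2k+216AB^2a^2k-72B^3a^2k-45A^3a^2-9A^2Ba^2+81AB^2a^2-27B^3a^2\\ &+12Aca-4Ab^2-12Bca+4Bb^2-24ea)l)/(6a)+(24A^3a^2k^3-72A^2Ba^2k^3\\ &+72AB^2a^2k^3-24B^3a^2k^3+36A^3a^2k^2-108A^2Ba^2k^2+108AB^2a^2k^2-36B^3a^2k^2\\ &+18A^3a^2k-54A^2Ba^2k+54AB^2a^2k-18B^3a^2k+3A^3a^2-9A^2Ba^2+9AB^2a^2-3B^3a^2\\ &+24Aack-8Ab^2k-24Back+8Bb^2k+12Aac-4Ab^2-12Bac+4Bb^2-24ae)/(12a),\\ H_4=&24a(A-B)(Ak+B)l^2+2(A-B)(12Aak^2+12Aak+18Bak+3Aa+15Ba+2b)l\\ &+12A^2ak^2-12B^2ak^2+12A^2ak+12ABak-24B^2ak+3aA^2+6ABa+4Abk-9B^2a\\ &-4Bbk+2Ab-2Bb-c,\\ H_5=&24a(A-B)(Ak+B)l^2+2(A-B)(12Aak^2+24Aak+6Bak-3Aa+21Ba-2b)l\\ &+24A^2ak^2-24ABak^2+24A^2ak-12ABak-12B^2ak-6A^2a+24ABa-18B^2a\\ &-4Ab+4Bb-c,\\ H_6=&48A^2ak(A-B)l^4+16a(A-B)(6A^2k^2+6A^2k+3ABk-A^2-AB+2B^2)l^3\\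 &+4(A-B)(12A^2ak^3+36A^2ak^2+18ABak^2+15A^2ak+15ABak+15B^2ak-6A^2a\\ &-3ABa+2Abk+15B^2a+2Bb)l^2+(48A^3ak^3-24A^2Bak^3-24AB^2ak^3+72A^3ak^2\\ &-36AB^2ak^2-36B^3ak^2+12A^3ak+30A^2Bak+8A^2bk^2+36AB^2ak-8ABbk^2\\ &-78B^3ak-6A^3a+12A^2Ba+8A^2bk+30AB^2a+4ABbk-36B^3a-12B^2bk+2A^2b\\ &+8ABb-10B^2b+2Ac-2Bc-4e)l+8A^3ak^3-8B^3ak^3+12A^3ak^2+12A^2Bak^2\\ &-24B^3ak^2+6A^3ak+12A^2Bak+4A^2bk^2+6AB^2ak-24B^3ak-4B^2bk^2+A^3a\\ &+3A^2Ba+4A^2bk+3AB^2a+4ABbk-7B^3a-8B^2bk+A^2b+2ABb+2Ack-3B^2b\\ &-2Bck+Ac-Bc-3e,\\ H_7=&48A^2ak(A-B)l^4+16a(A-B)(6A^2k^2+12A^2k-3ABk+A^2+AB-2B^2)l^3\\ &+4(A-B)(12A^2ak^3+72A^2ak^2-18ABak^2+81A^2ak-27ABak-9B^2ak\\ &+12A^2a+15ABa+2Abk-21B^2a+2Bb)l^2+(96A^3ak^3-120A^2Bak^3\\ &+24AB^2ak^3+312A^3ak^2-432A^2Bak^2+108AB^2ak^2+12B^3ak^2+264A^3ak\\ &-330A^2Bak+8A^2bk^2-8ABbk^2+66B^3ak+42A^3a+24A^2Ba+16A^2bk\\ &-138AB^2a-12ABbk+72B^3a-4B^2bk-2A^2b+16ABb-14B^2b-2Ac+2Bc\\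 &-4e)l+48A^3ak^3-72A^2Bak^3+24AB^2ak^3+120A^3ak^2-168A^2Bak^2+36AB^2ak^2\\ &+12B^3ak^2+84A^3ak-90A^2Bak+8A^2bk^2-24AB^2ak-8ABbk^2+30B^3ak+10A^3a\\ &+12A^2Ba+8A^2bk-42AB^2a-4ABbk+20B^3a-4B^2bk-2A^2b+8ABb-6B^2b\\ &-2Ac+2Bc-4e,\\ H_8=&48A^2ak(A-B)l^4+16a(A-B)(6A^2k^2+12A^2k+3ABk+A^2+AB-2B^2)l^3\\ &+4(A-B)(12A^2ak^3+72A^2ak^2+18ABak^2+81A^2ak+45ABak-9B^2ak+12A^2a\\ &+9ABa+2Abk-27B^2a-2Bb)l^2+(96A^3ak^3-72A^2Bak^3-24AB^2ak^3+312A^3ak^2\\ &-144A^2Bak^2-180AB^2ak^2+12B^3ak^2+264A^3ak-54A^2Bak+8A^2bk^2-288AB^2ak\\ &-8ABbk^2+78B^3ak+42A^3a-24A^2Ba+16A^2bk-138AB^2a-20ABbk+120B^3a\\ &+4B^2bk-2A^2b-16ABb+18B^2b-2Ac+2Bc-4e)l+48A^3ak^3-24A^2Bak^3\\ &-24AB^2ak^3+120A^3ak^2-24A^2Bak^2-108AB^2ak^2+12B^3ak^2+84A^3ak-6A^2Bak\\ &+8A^2bk^2-120AB^2ak-8ABbk^2+42B^3ak+10A^3a-12A^2Ba+8A^2bk-42AB^2a\\ &-12ABbk+44B^3a+4B^2bk-2A^2b-8ABb+10B^2b-2Ac+2Bc-4e. \end{align*} *)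

(* Defs.v *)
From HB Require Import structures.
From mathcomp Require Import all_boot all_order all_algebra.
From mathcomp Require Import all_classical all_reals.

Set Implicit Arguments.
Unset Strict Implicit.
Unset Printing Implicit Defensive.
Import Order.TTheory GRing.Theory Num.Theory.
Local Open Scope classical_set_scope.
Local Open Scope ring_scope.

(* The series \sum_n f n q^n is represented by its coefficients f. *)
Definition fps (R : Type) : Type := nat -> R.

Definition fps_of_poly (R : comUnitRingType) (p : {poly R}) : fps R :=
  fun n => p`_n.

Definition fps_one (R : comUnitRingType) : fps R := fps_of_poly 1.

Definition fps_mul (R : comUnitRingType) (f g : fps R) : fps R :=
  fun n => \sum_(i < n.+1) f i * g (n - i)%N.

(* The first n coefficients of 1 / f, obtained by solving f * (1 / f) = 1
   degree by degree. *)
Fixpoint fps_inv_seq (R : comUnitRingType) (f : fps R) (n : nat) : seq R :=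
  if n is m.+1 then
    let s := fps_inv_seq f m in
    rcons s ((f 0)^-1 * ((m == 0)%:R - \sum_(i < m) f (m - i)%N * s`_i))
  else [::].

Definition fps_inv (R : comUnitRingType) (f : fps R) : fps R :=
  fun n => (fps_inv_seq f n.+1)`_n.

Lemma size_fps_inv_seq (R : comUnitRingType) (f : fps R) n :
  size (fps_inv_seq f n) = n.
Proof. by elim: n => //= n IHn; rewrite size_rcons IHn. Qed.

Lemma nth_fps_inv_seq (R : comUnitRingType) (f : fps R) n i :
  (i < n)%N -> (fps_inv_seq f n)`_i = fps_inv f i.
Proof.
elim: n => // n IHn; rewrite ltnS leq_eqVlt => /predU1P[-> //|lt_in].
by rewrite /= nth_rcons size_fps_inv_seq lt_in IHn.
Qed.

Lemma fps_mulfV (R : comUnitRingType) (f : fps R) :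
  f 0 \is a GRing.unit -> fps_mul f (fps_inv f) = fps_one R.
Proof.
move=> Uf0; apply/funext => n.
have fVE : fps_inv f n = (f 0)^-1 *
    ((n == 0)%:R - \sum_(i < n) f (n - i)%N * fps_inv f i).
  rewrite {1}/fps_inv /= nth_rcons size_fps_inv_seq ltnn eqxx.
  congr (_ * (_ - _)); apply: eq_bigr => i _.
  by rewrite nth_fps_inv_seq.
have -> : fps_mul f (fps_inv f) n =
    \sum_(i < n.+1) f (n - i)%N * fps_inv f i.
  rewrite /fps_mul (reindex_inj rev_ord_inj) /=; apply: eq_bigr => i _.
  by rewrite subSS subKn // -ltnS.
by rewrite big_ord_recr /= subnn fVE mulVKr // addrC subrK /fps_one
  /fps_of_poly coef1.
Qed.

Definition inv_prod (R : comUnitRingType) (S : seq nat) : fps R :=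
  \big[@fps_mul R/fps_one R]_(s <- S) fps_inv (fps_of_poly (1 - 'X^s)).

Definition integer_valued (R : realType) (A B : R) : Prop :=
  forall x : int, A * x%:~R ^+ 2 + B * x%:~R \is a Num.int.

(* \sum_(j \notin [-k, k-1]) (-1)^(j+k) q^(A j^2 + B j); each power of q occurs
   for finitely many j as soon as A > 0. *)
Definition theta_tail (R : realType) (A B : R) (k : nat) : fps R :=
  fun n => \sum_(j \in [set j : int | ~ (- k%:Z <= j <= k%:Z - 1) /\
                          A * j%:~R ^+ 2 + B * j%:~R = n%:R])
             (-1 : R) ^ (j + k%:Z).

(* The finite set S is given by a duplicate-free list. *)
Definition gamma (R : realType) (S : seq nat) (A B : R) (k : nat) : fps R :=
  fps_mul (inv_prod R S) (theta_tail A B k).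

Definition coef_a (R : realType) (y1 y2 y3 y4 : R) : R :=
  1 / (6 * y1 * y2 * y3 * y4).

Definition coef_b (R : realType) (y1 y2 y3 y4 : R) : R :=
  (y1 + y2 + y3 + y4) / (4 * y1 * y2 * y3 * y4).

Definition coef_c (R : realType) (y1 y2 y3 y4 : R) : R :=
  (y1 ^+ 2 + y2 ^+ 2 + y3 ^+ 2 + y4 ^+ 2 +
   3 * (y1 * y2 + y1 * y3 + y1 * y4 + y2 * y3 + y2 * y4 + y3 * y4)) /
  (12 * y1 * y2 * y3 * y4).

Definition periodic_part (R : realType) (y1 y2 y3 y4 : nat) : fps R :=
  let a := coef_a y1%:R y2%:R y3%:R y4%:R in
  let b := coef_b y1%:R y2%:R y3%:R y4%:R in
  let c := coef_c y1%:R y2%:R y3%:R y4%:R in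
  fun n => inv_prod R [:: y1; y2; y3; y4] n -
           (a * n%:R ^+ 3 + b * n%:R ^+ 2 + c * n%:R).

Definition coef_D (R : realType) (y1 y2 y3 y4 : nat) : R :=
  sup (range (fun n => `|periodic_part R y1 y2 y3 y4 n|)).

Definition real_roots (R : realType) (p : {poly R}) : set R :=
  [set x | root p x].

(* The value is 0 if E has no greatest element. *)
Definition set_max (R : realType) (E : set R) : R := xget 0 (E `&` ubound E).

Definition max_root (R : realType) (G : seq {poly R}) : R :=
  set_max ([set 1] `|` \bigcup_(p in [set` G]) real_roots p).

Definition H1 (R : realType) (A B k a b c e : R) : {poly R} :=
  (12 * a * (A - B) * (2 * A * k - A - B)) *: 'X^2 +
  (6 * a * (2 * k + 1) * (A - B) * (2 * A * k - A - B)) *: 'X +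
  ((3 * a * c - b ^+ 2) / (3 * a))%:P.

Definition H2 (R : realType) (A B k a b c e : R) : {poly R} :=
  (48 * A ^+ 2 * a * k * (A - B)) *: 'X^4 +
  (16 * a * (A - B) * (6 * A ^+ 2 * k ^+ 2 + 3 * A * B * k + A ^+ 2 + A * B
   - 2 * B ^+ 2)) *: 'X^3 +
  (4 * (A - B) * (12 * A ^+ 2 * a * k ^+ 3 + 18 * A * B * a * k ^+ 2 +
   9 * A ^+ 2 * a * k + 9 * A * B * a * k - 9 * B ^+ 2 * a * k -
   3 * A * B * a + 2 * A * b * k - 3 * B ^+ 2 * a - 2 * B * b)) *: 'X^2 +
  (24 * A ^+ 2 * B * a * k ^+ 3 - 24 * A * B ^+ 2 * a * k ^+ 3 +
   24 * A ^+ 3 * a * k ^+ 2 - 36 * A * B ^+ 2 * a * k ^+ 2 +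
   12 * B ^+ 3 * a * k ^+ 2 - 6 * A ^+ 2 * B * a * k +
   8 * A ^+ 2 * b * k ^+ 2 - 8 * A * B * b * k ^+ 2 + 6 * B ^+ 3 * a * k -
   6 * A ^+ 3 * a + 6 * A * B ^+ 2 * a - 4 * A * B * b * k +
   4 * B ^+ 2 * b * k - 2 * A ^+ 2 * b + 2 * B ^+ 2 * b - 2 * A * c +
   2 * B * c - 4 * e) *: 'X +
  (-e)%:P.

Definition H3 (R : realType) (A B k a b c e : R) : {poly R} :=
  (48 * A ^+ 2 * a * k * (A - B)) *: 'X^4 +
  (8 * a * (A - B) * (9 * A ^+ 2 * k ^+ 2 + 12 * A ^+ 2 * k - 2 * A ^+ 2 -
   2 * B * A + B ^+ 2)) *: 'X^3 +
  (12 * a * (A - B) * (2 * A ^+ 2 * k ^+ 3 + 9 * A ^+ 2 * k ^+ 2 +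
   4 * A ^+ 2 * k - 2 * A * B * k + B ^+ 2 * k - 2 * A ^+ 2 - 2 * B * A +
   B ^+ 2)) *: 'X^2 +
  ((144 * A ^+ 3 * a ^+ 2 * k ^+ 3 - 144 * A ^+ 2 * B * a ^+ 2 * k ^+ 3 +
   252 * A ^+ 3 * a ^+ 2 * k ^+ 2 - 324 * A ^+ 2 * B * a ^+ 2 * k ^+ 2 +
   108 * A * B ^+ 2 * a ^+ 2 * k ^+ 2 - 36 * B ^+ 3 * a ^+ 2 * k ^+ 2 -
   144 * A ^+ 2 * B * a ^+ 2 * k + 216 * A * B ^+ 2 * a ^+ 2 * k -
   72 * B ^+ 3 * a ^+ 2 * k - 45 * A ^+ 3 * a ^+ 2 - 9 * A ^+ 2 * B * a ^+ 2
   + 81 * A * B ^+ 2 * a ^+ 2 - 27 * B ^+ 3 * a ^+ 2 + 12 * A * c * a -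
   4 * A * b ^+ 2 - 12 * B * c * a + 4 * B * b ^+ 2 - 24 * e * a) / (6 * a))
   *: 'X +
  ((24 * A ^+ 3 * a ^+ 2 * k ^+ 3 - 72 * A ^+ 2 * B * a ^+ 2 * k ^+ 3 +
   72 * A * B ^+ 2 * a ^+ 2 * k ^+ 3 - 24 * B ^+ 3 * a ^+ 2 * k ^+ 3 +
   36 * A ^+ 3 * a ^+ 2 * k ^+ 2 - 108 * A ^+ 2 * B * a ^+ 2 * k ^+ 2 +
   108 * A * B ^+ 2 * a ^+ 2 * k ^+ 2 - 36 * B ^+ 3 * a ^+ 2 * k ^+ 2 +
   18 * A ^+ 3 * a ^+ 2 * k - 54 * A ^+ 2 * B * a ^+ 2 * k +
   54 * A * B ^+ 2 * a ^+ 2 * k - 18 * B ^+ 3 * a ^+ 2 * k +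
   3 * A ^+ 3 * a ^+ 2 - 9 * A ^+ 2 * B * a ^+ 2 + 9 * A * B ^+ 2 * a ^+ 2 -
   3 * B ^+ 3 * a ^+ 2 + 24 * A * a * c * k - 8 * A * b ^+ 2 * k -
   24 * B * a * c * k + 8 * B * b ^+ 2 * k + 12 * A * a * c - 4 * A * b ^+ 2
   - 12 * B * a * c + 4 * B * b ^+ 2 - 24 * a * e) / (12 * a))%:P.

Definition H4 (R : realType) (A B k a b c e : R) : {poly R} :=
  (24 * a * (A - B) * (A * k + B)) *: 'X^2 +
  (2 * (A - B) * (12 * A * a * k ^+ 2 + 12 * A * a * k + 18 * B * a * k +
   3 * A * a + 15 * B * a + 2 * b)) *: 'X +
  (12 * A ^+ 2 * a * k ^+ 2 - 12 * B ^+ 2 * a * k ^+ 2 + 12 * A ^+ 2 * a * k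
   + 12 * A * B * a * k - 24 * B ^+ 2 * a * k + 3 * a * A ^+ 2 +
   6 * A * B * a + 4 * A * b * k - 9 * B ^+ 2 * a - 4 * B * b * k +
   2 * A * b - 2 * B * b - c)%:P.

Definition H5 (R : realType) (A B k a b c e : R) : {poly R} :=
  (24 * a * (A - B) * (A * k + B)) *: 'X^2 +
  (2 * (A - B) * (12 * A * a * k ^+ 2 + 24 * A * a * k + 6 * B * a * k -
   3 * A * a + 21 * B * a - 2 * b)) *: 'X +
  (24 * A ^+ 2 * a * k ^+ 2 - 24 * A * B * a * k ^+ 2 + 24 * A ^+ 2 * a * k
   - 12 * A * B * a * k - 12 * B ^+ 2 * a * k - 6 * A ^+ 2 * a +
   24 * A * B * a - 18 * B ^+ 2 * a - 4 * A * b + 4 * B * b - c)%:P.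

Definition H6 (R : realType) (A B k a b c e : R) : {poly R} :=
  (48 * A ^+ 2 * a * k * (A - B)) *: 'X^4 +
  (16 * a * (A - B) * (6 * A ^+ 2 * k ^+ 2 + 6 * A ^+ 2 * k + 3 * A * B * k
   - A ^+ 2 - A * B + 2 * B ^+ 2)) *: 'X^3 +
  (4 * (A - B) * (12 * A ^+ 2 * a * k ^+ 3 + 36 * A ^+ 2 * a * k ^+ 2 +
   18 * A * B * a * k ^+ 2 + 15 * A ^+ 2 * a * k + 15 * A * B * a * k +
   15 * B ^+ 2 * a * k - 6 * A ^+ 2 * a - 3 * A * B * a + 2 * A * b * k +
   15 * B ^+ 2 * a + 2 * B * b)) *: 'X^2 +
  (48 * A ^+ 3 * a * k ^+ 3 - 24 * A ^+ 2 * B * a * k ^+ 3 -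
   24 * A * B ^+ 2 * a * k ^+ 3 + 72 * A ^+ 3 * a * k ^+ 2 -
   36 * A * B ^+ 2 * a * k ^+ 2 - 36 * B ^+ 3 * a * k ^+ 2 +
   12 * A ^+ 3 * a * k + 30 * A ^+ 2 * B * a * k + 8 * A ^+ 2 * b * k ^+ 2 +
   36 * A * B ^+ 2 * a * k - 8 * A * B * b * k ^+ 2 - 78 * B ^+ 3 * a * k -
   6 * A ^+ 3 * a + 12 * A ^+ 2 * B * a + 8 * A ^+ 2 * b * k +
   30 * A * B ^+ 2 * a + 4 * A * B * b * k - 36 * B ^+ 3 * a -
   12 * B ^+ 2 * b * k + 2 * A ^+ 2 * b + 8 * A * B * b - 10 * B ^+ 2 * b +
   2 * A * c - 2 * B * c - 4 * e) *: 'X +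
  (8 * A ^+ 3 * a * k ^+ 3 - 8 * B ^+ 3 * a * k ^+ 3 +
   12 * A ^+ 3 * a * k ^+ 2 + 12 * A ^+ 2 * B * a * k ^+ 2 -
   24 * B ^+ 3 * a * k ^+ 2 + 6 * A ^+ 3 * a * k + 12 * A ^+ 2 * B * a * k +
   4 * A ^+ 2 * b * k ^+ 2 + 6 * A * B ^+ 2 * a * k - 24 * B ^+ 3 * a * k -
   4 * B ^+ 2 * b * k ^+ 2 + A ^+ 3 * a + 3 * A ^+ 2 * B * a +
   4 * A ^+ 2 * b * k + 3 * A * B ^+ 2 * a + 4 * A * B * b * k -
   7 * B ^+ 3 * a - 8 * B ^+ 2 * b * k + A ^+ 2 * b + 2 * A * B * b +
   2 * A * c * k - 3 * B ^+ 2 * b - 2 * B * c * k + A * c - B * c -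
   3 * e)%:P.

Definition H7 (R : realType) (A B k a b c e : R) : {poly R} :=
  (48 * A ^+ 2 * a * k * (A - B)) *: 'X^4 +
  (16 * a * (A - B) * (6 * A ^+ 2 * k ^+ 2 + 12 * A ^+ 2 * k - 3 * A * B * k
   + A ^+ 2 + A * B - 2 * B ^+ 2)) *: 'X^3 +
  (4 * (A - B) * (12 * A ^+ 2 * a * k ^+ 3 + 72 * A ^+ 2 * a * k ^+ 2 -
   18 * A * B * a * k ^+ 2 + 81 * A ^+ 2 * a * k - 27 * A * B * a * k -
   9 * B ^+ 2 * a * k + 12 * A ^+ 2 * a + 15 * A * B * a + 2 * A * b * k -
   21 * B ^+ 2 * a + 2 * B * b)) *: 'X^2 +
  (96 * A ^+ 3 * a * k ^+ 3 - 120 * A ^+ 2 * B * a * k ^+ 3 +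
   24 * A * B ^+ 2 * a * k ^+ 3 + 312 * A ^+ 3 * a * k ^+ 2 -
   432 * A ^+ 2 * B * a * k ^+ 2 + 108 * A * B ^+ 2 * a * k ^+ 2 +
   12 * B ^+ 3 * a * k ^+ 2 + 264 * A ^+ 3 * a * k -
   330 * A ^+ 2 * B * a * k + 8 * A ^+ 2 * b * k ^+ 2 -
   8 * A * B * b * k ^+ 2 + 66 * B ^+ 3 * a * k + 42 * A ^+ 3 * a +
   24 * A ^+ 2 * B * a + 16 * A ^+ 2 * b * k - 138 * A * B ^+ 2 * a -
   12 * A * B * b * k + 72 * B ^+ 3 * a - 4 * B ^+ 2 * b * k -
   2 * A ^+ 2 * b + 16 * A * B * b - 14 * B ^+ 2 * b - 2 * A * c + 2 * B * c
   - 4 * e) *: 'X +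
  (48 * A ^+ 3 * a * k ^+ 3 - 72 * A ^+ 2 * B * a * k ^+ 3 +
   24 * A * B ^+ 2 * a * k ^+ 3 + 120 * A ^+ 3 * a * k ^+ 2 -
   168 * A ^+ 2 * B * a * k ^+ 2 + 36 * A * B ^+ 2 * a * k ^+ 2 +
   12 * B ^+ 3 * a * k ^+ 2 + 84 * A ^+ 3 * a * k - 90 * A ^+ 2 * B * a * k
   + 8 * A ^+ 2 * b * k ^+ 2 - 24 * A * B ^+ 2 * a * k -
   8 * A * B * b * k ^+ 2 + 30 * B ^+ 3 * a * k + 10 * A ^+ 3 * a +
   12 * A ^+ 2 * B * a + 8 * A ^+ 2 * b * k - 42 * A * B ^+ 2 * a -
   4 * A * B * b * k + 20 * B ^+ 3 * a - 4 * B ^+ 2 * b * k - 2 * A ^+ 2 * b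
   + 8 * A * B * b - 6 * B ^+ 2 * b - 2 * A * c + 2 * B * c - 4 * e)%:P.

Definition H8 (R : realType) (A B k a b c e : R) : {poly R} :=
  (48 * A ^+ 2 * a * k * (A - B)) *: 'X^4 +
  (16 * a * (A - B) * (6 * A ^+ 2 * k ^+ 2 + 12 * A ^+ 2 * k + 3 * A * B * k
   + A ^+ 2 + A * B - 2 * B ^+ 2)) *: 'X^3 +
  (4 * (A - B) * (12 * A ^+ 2 * a * k ^+ 3 + 72 * A ^+ 2 * a * k ^+ 2 +
   18 * A * B * a * k ^+ 2 + 81 * A ^+ 2 * a * k + 45 * A * B * a * k -
   9 * B ^+ 2 * a * k + 12 * A ^+ 2 * a + 9 * A * B * a + 2 * A * b * k -
   27 * B ^+ 2 * a - 2 * B * b)) *: 'X^2 +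
  (96 * A ^+ 3 * a * k ^+ 3 - 72 * A ^+ 2 * B * a * k ^+ 3 -
   24 * A * B ^+ 2 * a * k ^+ 3 + 312 * A ^+ 3 * a * k ^+ 2 -
   144 * A ^+ 2 * B * a * k ^+ 2 - 180 * A * B ^+ 2 * a * k ^+ 2 +
   12 * B ^+ 3 * a * k ^+ 2 + 264 * A ^+ 3 * a * k - 54 * A ^+ 2 * B * a * k
   + 8 * A ^+ 2 * b * k ^+ 2 - 288 * A * B ^+ 2 * a * k -
   8 * A * B * b * k ^+ 2 + 78 * B ^+ 3 * a * k + 42 * A ^+ 3 * a -
   24 * A ^+ 2 * B * a + 16 * A ^+ 2 * b * k - 138 * A * B ^+ 2 * a -
   20 * A * B * b * k + 120 * B ^+ 3 * a + 4 * B ^+ 2 * b * k -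
   2 * A ^+ 2 * b - 16 * A * B * b + 18 * B ^+ 2 * b - 2 * A * c + 2 * B * c
   - 4 * e) *: 'X +
  (48 * A ^+ 3 * a * k ^+ 3 - 24 * A ^+ 2 * B * a * k ^+ 3 -
   24 * A * B ^+ 2 * a * k ^+ 3 + 120 * A ^+ 3 * a * k ^+ 2 -
   24 * A ^+ 2 * B * a * k ^+ 2 - 108 * A * B ^+ 2 * a * k ^+ 2 +
   12 * B ^+ 3 * a * k ^+ 2 + 84 * A ^+ 3 * a * k - 6 * A ^+ 2 * B * a * k +
   8 * A ^+ 2 * b * k ^+ 2 - 120 * A * B ^+ 2 * a * k -
   8 * A * B * b * k ^+ 2 + 42 * B ^+ 3 * a * k + 10 * A ^+ 3 * a -
   12 * A ^+ 2 * B * a + 8 * A ^+ 2 * b * k - 42 * A * B ^+ 2 * a -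
   12 * A * B * b * k + 44 * B ^+ 3 * a + 4 * B ^+ 2 * b * k -
   2 * A ^+ 2 * b - 8 * A * B * b + 10 * B ^+ 2 * b - 2 * A * c + 2 * B * c
   - 4 * e)%:P.

Definition Hpolys (R : realType) (A B : R) (k y1 y2 y3 y4 : nat) :
    seq {poly R} :=
  let a := coef_a y1%:R y2%:R y3%:R y4%:R in
  let b := coef_b y1%:R y2%:R y3%:R y4%:R in
  let c := coef_c y1%:R y2%:R y3%:R y4%:R in
  let e := coef_D R y1 y2 y3 y4 in
  [:: H1 A B k%:R a b c e; H2 A B k%:R a b c e; H3 A B k%:R a b c e;
      H4 A B k%:R a b c e; H5 A B k%:R a b c e; H6 A B k%:R a b c e;
      H7 A B k%:R a b c e; H8 A B k%:R a b c e].

Definition Lbound (R : realType) (A B : R) (k y1 y2 y3 y4 : nat) : int :=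
  Num.ceil (max_root (Hpolys A B k y1 y2 y3 y4)).

Definition Nbound (R : realType) (A B : R) (k y1 y2 y3 y4 : nat) : R :=
  let x := k%:R + 2 * (Lbound A B k y1 y2 y3 y4)%:~R in
  A * x ^+ 2 + B * x.

(* Main.v *)
(** Write Q(x) = A x^2 + B x, let p(n) be the coefficients of
    1 / prod (1 - q^{y_i}), put f(x) = a x^3 + b x^2 + c x and s = p - f.
    Pairwise coprimality of the cyclotomic quotients (1 - X^{y_i}) / (1 - X)
    shows that (1 - X^{y_1 y_2 y_3 y_4}) s is a polynomial, so |s| <= e.  The
    exponents of the tail, in increasing order, form blocks
    Q(x) <= Q(-x-1) <= Q(x+1) <= Q(-x-2) with x = k + 2i and signs + - - +.
    If Q(k+2l) <= n < Q(k+2l+2), the coefficient at n consists of l full blocks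
    and the first one to four terms of the next one.  Replacing p by f costs e
    per term, and the remaining polynomial in n is bounded below on the
    corresponding range of n by elementary calculus: H2, H6, H7, H8 are its
    values at endpoints of the range, H3 is its minimum over the reals, H1 is
    the minimum of its derivative, and H4, H5 are the values of its derivative
    at the endpoints.  All H_i are nonnegative at l since l is at least their
    largest root and their leading coefficients are positive. *)
Require Import Defs.
From HB Require Import structures.
From mathcomp Require Import all_boot all_order all_algebra.
From mathcomp Require Import all_classical all_reals.
From mathcomp Require Import ring lra zify.
From mathcomp Require Import polyrcf.

Set Implicit Arguments.
Unset Strict Implicit.
Unset Printing Implicit Defensive.
Import Order.TTheory GRing.Theory Num.Theory.
Local Open Scope classical_set_scope.
Local Open Scope ring_scope.

(** * Formal power series and cyclotomic quotients *)

Section FormalPowerSeries.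
Variable R : comUnitRingType.
Implicit Types (f g h : fps R) (p q : {poly R}).

(** A coefficient of a product only sees finitely many coefficients of the factors, so commutativity
    and associativity are inherited from polynomials. *)
Lemma fps_mul_trunc f g N n : (n < N)%N ->
  fps_mul f g n = (\poly_(i < N) f i * \poly_(i < N) g i)`_n.
Proof.
move=> nN; rewrite coefM; apply: eq_bigr => i _.
by rewrite !coef_poly (leq_ltn_trans _ nN) ?(leq_ltn_trans _ nN) ?leq_subr
  -1?ltnS.
Qed.

Lemma fps_mulC f g : fps_mul f g = fps_mul g f.
Proof. by apply/funext => n; rewrite !(fps_mul_trunc _ _ (ltnSn n)) mulrC. Qed.

Lemma fps_mulA f g h : fps_mul f (fps_mul g h) = fps_mul (fps_mul f g) h.
Proof.
apply/funext => n; pose T u := \poly_(i < n.+1) (u : fps R) i.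
transitivity (T f * (T g * T h))`_n.
  rewrite coefM; apply: eq_bigr => i _; rewrite coef_poly ltn_ord.
  by rewrite (@fps_mul_trunc _ _ n.+1) // ltnS leq_subr.
rewrite mulrA coefM; apply: eq_bigr => i _; rewrite coef_poly ltnS leq_subr.
by rewrite (@fps_mul_trunc _ _ n.+1).
Qed.

Lemma fps_of_polyM p q :
  fps_of_poly (p * q) = fps_mul (fps_of_poly p) (fps_of_poly q).
Proof. by apply/funext => n; rewrite /fps_of_poly coefM. Qed.

Lemma fps_mul1f f : fps_mul (fps_one R) f = f.
Proof.
apply/funext => n; rewrite /fps_mul big_ord_recl subn0 big1 ?addr0.
  by rewrite /fps_one /fps_of_poly coef1 mul1r.
by move=> i _; rewrite /fps_one /fps_of_poly coef1 mul0r.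
Qed.

Lemma fps_mul_inj f g h : f 0 \is a GRing.unit ->
  fps_mul f g = fps_mul f h -> g = h.
Proof.
move=> Uf /(congr1 (fps_mul (fps_inv f))).
by rewrite !fps_mulA (fps_mulC _ f) fps_mulfV // !fps_mul1f.
Qed.

Lemma fps_mul_inv_prod (S : seq nat) : all (leq 1) S ->
  fps_mul (fps_of_poly (\prod_(s <- S) (1 - 'X^s))) (inv_prod R S) = fps_one R.
Proof.
elim: S => [|s S IHS] /=; first by rewrite /inv_prod !big_nil fps_mul1f.
move=> /andP[s_gt0 /IHS IH]; rewrite /inv_prod !big_cons -/(inv_prod R S).
rewrite fps_of_polyM (fps_mulC (fps_of_poly (1 - _))) -fps_mulA.
rewrite (fps_mulA _ _ (inv_prod R S)) fps_mulfV ?fps_mul1f //.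
by rewrite /fps_of_poly coefB coef1 coefXn (ltn_eqF s_gt0) subr0 unitr1.
Qed.

End FormalPowerSeries.

Lemma fps_mul_polyB (R : comUnitRingType) (p : {poly R}) (f g : fps R) n :
  fps_mul (fps_of_poly p) (fun m => f m - g m) n =
  fps_mul (fps_of_poly p) f n - fps_mul (fps_of_poly p) g n.
Proof.
by rewrite /fps_mul -sumrB; apply: eq_bigr => i _; rewrite mulrBr.
Qed.

Lemma fps_mul_1subXn (R : comUnitRingType) d (f : fps R) n : (0 < d)%N ->
  fps_mul (fps_of_poly (1 - 'X^d)) f n =
  f n - (if (d <= n)%N then f (n - d)%N else 0).
Proof.
move=> d_gt0; rewrite /fps_mul /fps_of_poly.
under eq_bigr => i _ do rewrite coefB coef1 coefXn mulrBl.
rewrite sumrB big_ord_recl subn0 mul1r big1 ?addr0; last first.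
  by move=> i _; rewrite mul0r.
congr (_ - _); case: ifPn => [dn|nd].
  have dn1 : (d < n.+1)%N by rewrite ltnS.
  rewrite (bigD1 (Ordinal dn1)) //= eqxx mul1r big1 ?addr0 // => i.
  by rewrite -val_eqE /= => /negPf ->; rewrite mul0r.
rewrite big1 // => i _; case: eqP => [id|_]; last by rewrite mul0r.
by case/negP: nd; rewrite -id -ltnS.
Qed.

Section Cyclotomy.
Variable R : realFieldType.

Definition geom (y : nat) : {poly R} := \sum_(i < y) 'X^i.

Lemma geomE y : 1 - 'X^y = (1 - 'X) * geom y.
Proof.
rewrite /geom -{1}(expr1n _ y) subrXX; congr (_ * _).
by apply: eq_bigr => i _; rewrite expr1n mul1r.
Qed.

(* From [u m = v n + 1], (1 - X^(u m)) - X (1 - X^(v n)) = 1 - X. *)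
Lemma coprime_geom m n : (0 < m)%N -> (0 < n)%N -> coprime m n ->
  coprimep (geom m) (geom n).
Proof.
move=> m_gt0 n_gt0 co_mn; have [u v uvE _] := egcdnP n m_gt0.
rewrite (eqP co_mn) in uvE.
have X1_neq0 : (1 - 'X : {poly R}) != 0.
  by rewrite -oppr_eq0 opprB polyXsubC_eq0.
have dvdg a b : (geom a %| geom (b * a)).
  apply/dvdpP; exists (\sum_(i < b) 'X^(a * i)).
  apply: (mulfI X1_neq0); rewrite -geomE mulrCA -geomE mulrC mulnC exprM.
  rewrite -{1}(expr1n _ b) subrXX; congr (_ * _); apply: eq_bigr => i _.
  by rewrite expr1n mul1r exprM.
have E : geom (u * m) - 'X * geom (v * n) = 1.
  apply: (mulfI X1_neq0); rewrite mulrBr mulrCA -!geomE uvE mulr1.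
  by rewrite addn1 exprS mulrBr mulr1; ring.
suff : gcdp (geom m) (geom n) %| 1 by rewrite dvdp1 coprimep_def.
rewrite -E dvdp_sub ?dvdp_mull //.
  exact: dvdp_trans (dvdp_gcdl _ _) (dvdg _ _).
exact: dvdp_trans (dvdp_gcdr _ _) (dvdg _ _).
Qed.

(** At 1 the polynomial [geom y] takes the value [y], nonzero in characteristic 0. *)
Lemma coprime_1subX_geom y : (0 < y)%N -> coprimep (1 - 'X) (geom y).
Proof.
move=> y_gt0; rewrite -[1 - 'X]opprB -scaleN1r.
rewrite coprimepZl ?oppr_eq0 ?oner_eq0 // coprimep_sym coprimep_XsubC.
rewrite /root /geom horner_sum.
under eq_bigr => i _ do rewrite hornerXn expr1n.
by rewrite sumr_const card_ord pnatr_eq0 -lt0n.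
Qed.

Lemma geom_dvd y m : (y %| m)%N -> (1 - 'X) * geom y %| (1 - 'X^m : {poly R}).
Proof.
case/dvdnP => b ->; rewrite -geomE mulnC exprM -{2}(expr1n _ b) subrXX.
exact: dvdp_mulr.
Qed.

(** Each factor divides separately, and the factors are pairwise coprime, so Gauss's lemma gives the
    product. *)
Lemma prod_geom_dvd (y1 y2 y3 y4 : nat) : all (leq 1) [:: y1; y2; y3; y4] ->
  pairwise coprime [:: y1; y2; y3; y4] ->
  (1 - 'X) * (geom y1 * geom y2 * geom y3 * geom y4) %|
    (1 - 'X^(y1 * y2 * y3 * y4) : {poly R}).
Proof.
move=> /= /and5P[y1_gt0 y2_gt0 y3_gt0 y4_gt0 _].
case/and4P=> /and4P[c12 c13 c14 _] /and3P[c23 c24 _] /andP[c34 _] _.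
have d y : (y %| y1 * y2 * y3 * y4)%N ->
    geom y %| (1 - 'X^(y1 * y2 * y3 * y4) : {poly R}).
  by move/geom_dvd; apply: dvdp_trans; exact: dvdp_mull.
have d0 : (1 - 'X) %| (1 - 'X^(y1 * y2 * y3 * y4) : {poly R}).
  by apply: dvdp_trans (geom_dvd (dvdnn _)); exact: dvdp_mulr.
rewrite Gauss_dvdp ?d0 /=; last by rewrite !coprimepMr !coprime_1subX_geom.
rewrite Gauss_dvdp; last by rewrite !coprimepMl !coprime_geom.
rewrite Gauss_dvdp; last by rewrite !coprimepMl !coprime_geom.
rewrite Gauss_dvdp; last by rewrite !coprime_geom.
rewrite !d //; apply/dvdnP.
- by exists (y1 * y2 * y3)%N; lia.
- by exists (y1 * y2 * y4)%N; lia.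
- by exists (y1 * y3 * y4)%N; lia.
- by exists (y2 * y3 * y4)%N; lia.
Qed.

End Cyclotomy.

(** * The periodic part is bounded *)

Section PeriodicPart.
Variable R : realType.
Implicit Types (p q : {poly R}).

(** Taylor expansion at X = 1 in powers of 1 - X. Order two suffices: it lowers a pole of order four
    at 1 to a simple one. *)
Definition jet2 p (c0 c1 c2 : R) : Prop :=
  exists r, p = c0%:P + c1%:P * (1 - 'X) + c2%:P * (1 - 'X) ^+ 2
                + (1 - 'X) ^+ 3 * r.

Lemma jet2M p q a0 a1 a2 b0 b1 b2 : jet2 p a0 a1 a2 -> jet2 q b0 b1 b2 ->
  jet2 (p * q) (a0 * b0) (a0 * b1 + a1 * b0) (a0 * b2 + a1 * b1 + a2 * b0).
Proof.
move=> [r ->] [s ->]; rewrite /jet2; set T := 1 - 'X.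
exists (a1%:P * b2%:P + a2%:P * b1%:P + a2%:P * b2%:P * T +
  (a0%:P + a1%:P * T + a2%:P * T ^+ 2) * s +
  r * (b0%:P + b1%:P * T + b2%:P * T ^+ 2) + T ^+ 3 * r * s).
by ring.
Qed.

Lemma jet2_Xn n : jet2 'X^n 1 (- n%:R) (n%:R * (n%:R - 1) / 2).
Proof.
elim: n => [|n [r IH]].
  by exists 0; rewrite expr0 !mul0r oppr0 mul0r !addr0 mulr0 addr0.
exists (- ((n%:R * (n%:R - 1) / 2)%:P) + 'X * r).
rewrite exprS IH -(natr1 n).
have -> : (n%:R + 1) * (n%:R + 1 - 1) / 2 =
  n%:R * (n%:R - 1) / 2 + n%:R :> R by field.
by ring.
Qed.

(** With T = 1 - X, [geom y] is (1 - (1 - T)^y) / T, whence the signed binomials of [y] over 1, 2,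
    3. *)
Lemma jet2_geom y : jet2 (geom R y) y%:R (- (y%:R * (y%:R - 1) / 2))
  (y%:R * (y%:R - 1) * (y%:R - 2) / 6).
Proof.
elim: y => [|y [r IH]].
  by exists 0; rewrite /geom big_ord0 mulr0n !mul0r oppr0 polyC0 !mul0r
    mulr0 !addr0.
have [s Xy] := jet2_Xn y; exists (r + s).
rewrite /geom big_ord_recr /= -/(geom R y) IH Xy -(natr1 y).
have -> : (y%:R + 1) * (y%:R + 1 - 1) / 2 =
  y%:R * (y%:R - 1) / 2 + y%:R :> R by field.
have -> : (y%:R + 1) * (y%:R + 1 - 1) * (y%:R + 1 - 2) / 6 =
  y%:R * (y%:R - 1) * (y%:R - 2) / 6 + y%:R * (y%:R - 1) / 2 :> R by field.
by ring.
Qed.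

(* Numerator of \sum_n (a n^3 + b n^2 + c n) X^n over (1 - X)^4. *)
Definition cubic_num (a b c : R) : {poly R} :=
  a%:P * ('X + 'X ^+ 2 *+ 4 + 'X ^+ 3) + b%:P * ('X + 'X ^+ 2) * (1 - 'X) +
  c%:P * 'X * (1 - 'X) ^+ 2.

Lemma jet2_cubic_num a b c :
  jet2 (cubic_num a b c) (6 * a) (2 * b - 12 * a) (7 * a - 3 * b + c).
Proof. by exists ((b - a - c)%:P); rewrite /cubic_num; ring. Qed.

Lemma fps_mul_cubic (a b c : R) :
  fps_mul (fps_of_poly ((1 - 'X) ^+ 4))
    (fun n => a * n%:R ^+ 3 + b * n%:R ^+ 2 + c * n%:R) =
  fps_of_poly (cubic_num a b c).
Proof.
apply/funext => n.
rewrite 3!exprS expr1 !fps_of_polyM -!fps_mulA -['X]expr1.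
rewrite !fps_mul_1subXn //.
have -> : (cubic_num a b c) =
  c%:P * 'X + a%:P * 'X + b%:P * 'X + (4 * a - 2 * c)%:P * 'X^2 +
  (a - b + c)%:P * 'X^3 by rewrite /cubic_num; ring.
rewrite /fps_of_poly !coefD !coefCM !coefX !coefXn.
(* The left side is a fourth difference: from index 4 on it vanishes on cubics, and the first four
   indices are boundary cases. *)
case: n => [|[|[|[|n]]]] /=; rewrite ?subn1 /=.
1-5: by ring.
Qed.

(** From index [d + size q] on, [s n = s (n - d)], so every value already occurs among the initial
    ones. *)
Lemma bounded_of_1subXn (d : nat) (s : fps R) (q : {poly R}) : (0 < d)%N ->
  fps_mul (fps_of_poly (1 - 'X^d)) s = fps_of_poly q ->
  exists C, forall n, `|s n| <= C.
Proof.
move=> d_gt0 sq; exists (\sum_(i < d + size q) `|s i|).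
elim/ltn_ind => n IH; have [lt_n|le_n] := ltnP n (d + size q).
  by rewrite (bigD1 (Ordinal lt_n)) //= lerDl sumr_ge0.
have dn : (d <= n)%N by apply: leq_trans le_n; rewrite leq_addr.
have /(congr1 (@^~ n)) := sq; rewrite fps_mul_1subXn // dn /fps_of_poly.
rewrite nth_default ?(leq_trans _ le_n) ?leq_addl // => /subr0_eq ->.
by apply: IH; rewrite ltn_subrL d_gt0 (leq_trans d_gt0).
Qed.

Lemma periodic_part_bounded (y1 y2 y3 y4 : nat) :
  all (leq 1) [:: y1; y2; y3; y4] -> pairwise coprime [:: y1; y2; y3; y4] ->
  exists C, forall n, `|periodic_part R y1 y2 y3 y4 n| <= C.
Proof.
move=> y_gt0 y_co; set s := periodic_part R y1 y2 y3 y4.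
pose a : R := coef_a y1%:R y2%:R y3%:R y4%:R.
pose b : R := coef_b y1%:R y2%:R y3%:R y4%:R.
pose c : R := coef_c y1%:R y2%:R y3%:R y4%:R.
pose T : {poly R} := 1 - 'X.
pose P := geom R y1 * geom R y2 * geom R y3 * geom R y4.
(* The constants [a], [b], [c] are exactly those cancelling the poles of orders 4, 3 and 2 at 1;
   what remains is -M / (T P). *)
have [M PN] : jet2 (P * cubic_num a b c) 1 0 0.
  have := jet2M (jet2M (jet2M (jet2M (jet2_geom y1) (jet2_geom y2))
    (jet2_geom y3)) (jet2_geom y4)) (jet2_cubic_num a b c).
  move: y_gt0; rewrite /= !lt0n.
  rewrite -!(pnatr_eq0 R) => /and5P[y1_n0 y2_n0 y3_n0 y4_n0 _].
  congr (jet2 _ _ _ _); rewrite /a /b /c /coef_a /coef_b /coef_c.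
  1-3: by field; rewrite y1_n0 y2_n0 y3_n0 y4_n0.
have W : \prod_(s <- [:: y1; y2; y3; y4]) (1 - 'X^s) = P * T ^+ 4 :> {poly R}.
  by rewrite !big_cons big_nil !geomE /P /T; ring.
have Ts : fps_mul (fps_of_poly (T * P)) s = fps_of_poly (- M).
  (* [T ^+ 3] has constant coefficient 1, so it may be cancelled. *)
  apply: (@fps_mul_inj _ (fps_of_poly (T ^+ 3))).
    by rewrite /fps_of_poly -horner_coef0 !hornerE subr0 expr1n unitr1.
  rewrite fps_mulA -!fps_of_polyM.
  have -> : T ^+ 3 * (T * P) = \prod_(s <- [:: y1; y2; y3; y4]) (1 - 'X^s).
    by rewrite W; ring.
  apply/funext => n; rewrite fps_mul_polyB fps_mul_inv_prod // W.
  rewrite (fps_of_polyM P) -fps_mulA fps_mul_cubic -!fps_of_polyM PN.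
  rewrite /fps_one /fps_of_poly -coefB; congr (polyseq _)`_n.
  by rewrite /T; ring.
have /dvdpP[E EE] := @prod_geom_dvd R _ _ _ _ y_gt0 y_co.
have Y_gt0 : (0 < y1 * y2 * y3 * y4)%N.
  by move: y_gt0 => /= /and5P[h1 h2 h3 h4 _]; rewrite !muln_gt0 h1 h2 h3 h4.
apply: (@bounded_of_1subXn _ _ (E * - M) Y_gt0).
by rewrite EE fps_of_polyM -fps_mulA Ts -fps_of_polyM.
Qed.

Lemma periodic_part_le (y1 y2 y3 y4 : nat) n :
  all (leq 1) [:: y1; y2; y3; y4] -> pairwise coprime [:: y1; y2; y3; y4] ->
  `|periodic_part R y1 y2 y3 y4 n| <= coef_D R y1 y2 y3 y4.
Proof.
move=> y_gt0 y_co; apply: sup_upper_bound; last by exists n.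
split; first by exists `|periodic_part R y1 y2 y3 y4 0|, 0.
have [C sC] := periodic_part_bounded y_gt0 y_co.
by exists C => _ [m _ <-].
Qed.

End PeriodicPart.

(** * Nonnegativity past the largest root *)

Section MaxRoot.
Variable R : realType.
Implicit Types (p : {poly R}) (G : seq {poly R}).

Lemma seq_has_max (x : R) (s : seq R) :
  exists2 m, m \in x :: s & forall y, y \in x :: s -> y <= m.
Proof.
elim: s => [|z s [m ms m_max]].
  by exists x; rewrite ?mem_head // => y; rewrite inE => /eqP ->.
exists (Num.max m z).
  rewrite maxEle; case: ifP => _; first by rewrite !inE eqxx orbT.
  by move: ms; rewrite !inE => /orP[->//|->]; rewrite !orbT.
move=> y; rewrite !inE le_max => /or3P[/eqP->|/eqP->|ys].
- by rewrite m_max ?mem_head.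
- by rewrite lexx orbT.
- by rewrite m_max // inE ys orbT.
Qed.

(** [set_max] is meaningful only if a greatest element exists. Here the roots are those of one
    nonzero product, hence finite in number. *)
Lemma max_root_spec G : (forall p, p \in G -> p != 0) ->
  1 <= max_root G /\
  forall p x, p \in G -> root p x -> x <= max_root G.
Proof.
move=> G_neq0; set E := [set 1] `|` \bigcup_(p in [set` G]) real_roots p.
pose P := \prod_(p <- G) p.
have P_neq0 : P != 0 by rewrite prodf_seq_neq0; apply/allP => p /G_neq0.
have rootsE x : (x \in rootsR P) = root P x.
  by rewrite -(roots_on_rootsR P_neq0) in_itv.
have rootP p x : p \in G -> root p x -> x \in rootsR P.
  move=> pG px; rewrite rootsE /P (big_rem p pG) /=.
  by rewrite rootM px.
have EP x : E x -> x \in 1 :: rootsR P.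
  case=> [->|[p pG px]]; first by rewrite mem_head.
  by rewrite inE (rootP p) ?orbT.
have PE x : x \in 1 :: rootsR P -> E x.
  rewrite inE => /predU1P[->|]; first by left.
  rewrite rootsE rootE /P horner_prod prodf_seq_eq0 => /hasP[p pG px].
  by right; exists p.
have [m mP m_max] := seq_has_max 1 (rootsR P).
have : (E `&` ubound E) (max_root G).
  by apply: (@xgetI _ _ _ m); split; [exact: PE|move=> y /EP /m_max].
case=> _ ub; split=> [|p x pG px]; apply: ub; first by left.
by right; exists p.
Qed.

(** If [p.[x]] is nonzero, then [p] has no root from [x] on, and its sign at [x] is its sign at
    infinity. *)
Lemma horner_ge0_past_roots p x : 0 < lead_coef p ->
  (forall y, root p y -> y <= x) -> 0 <= p.[x].
Proof.
move=> p_gt0 px; have [->//|px_neq0] := eqVneq p.[x] 0.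
rewrite -sgr_ge0 (@sgp_pinftyP _ x p) ?in_itv /= ?lexx //.
  by rewrite /sgp_pinfty sgr_ge0 ltW.
move=> y; rewrite in_itv /= andbT => xy; apply/negP => py.
have /eqP yx : y == x by rewrite eq_le px.
by move: px_neq0; rewrite -yx -rootE py.
Qed.

Lemma max_root_ge0 G : (forall p, p \in G -> 0 < lead_coef p) ->
  1 <= max_root G /\ forall p x, p \in G -> max_root G <= x -> 0 <= p.[x].
Proof.
move=> G_gt0; have [|G1 Gr] := @max_root_spec G.
  by move=> p /G_gt0; rewrite -lead_coef_eq0; exact: lt0r_neq0.
split=> // p x pG Gx; apply: horner_ge0_past_roots; first exact: G_gt0.
by move=> y py; apply: le_trans Gx; exact: Gr py.
Qed.

Lemma lead_coef_gt0_addl (c : R) n p : 0 < c -> (size p <= n)%N ->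
  0 < lead_coef (c *: 'X^n + p).
Proof.
move=> c_gt0 pn; rewrite lead_coefDl.
  by rewrite lead_coefZ lead_coefXn mulr1.
by rewrite size_scale ?gt_eqF // size_polyXn ltnS.
Qed.

Lemma lead_coef_quadratic_gt0 (c2 c1 c0 : R) : 0 < c2 ->
  0 < lead_coef (c2 *: 'X^2 + c1 *: 'X + c0%:P).
Proof.
move=> c2_gt0; rewrite -addrA lead_coef_gt0_addl //.
rewrite (leq_trans (size_polyD _ _)) // geq_max.
by rewrite (leq_trans (size_scale_leq _ _)) ?size_polyX // 
  (leq_trans (size_polyC_leq1 _)).
Qed.

Lemma lead_coef_quartic_gt0 (c4 c3 c2 c1 c0 : R) : 0 < c4 ->
  0 < lead_coef (c4 *: 'X^4 + c3 *: 'X^3 + c2 *: 'X^2 + c1 *: 'X + c0%:P).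
Proof.
move=> c4_gt0; rewrite -!addrA lead_coef_gt0_addl //.
do 3!rewrite (leq_trans (size_polyD _ _)) // geq_max
  (leq_trans (size_scale_leq _ _)) ?size_polyXn ?size_polyX //=.
exact: leq_trans (size_polyC_leq1 _) _.
Qed.

End MaxRoot.

Section Hpolys.
Variables (R : realType) (A B : R) (k y1 y2 y3 y4 : nat).
Hypotheses (B_ge0 : 0 <= B) (ltBA : B < A) (k_gt0 : (0 < k)%N).
Hypothesis (y_gt0 : all (leq 1) [:: y1; y2; y3; y4]).

Lemma coef_a_gt0 : 0 < coef_a y1%:R y2%:R y3%:R y4%:R :> R.
Proof.
move: y_gt0 => /= /and5P[h1 h2 h3 h4 _].
by rewrite /coef_a divr_gt0 // !mulr_gt0 // ltr0n.
Qed.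

Lemma Hpolys_lead_gt0 p : p \in Hpolys A B k y1 y2 y3 y4 -> 0 < lead_coef p.
Proof.
have a_gt0 := coef_a_gt0; have A_gt0 : 0 < A by exact: le_lt_trans ltBA.
have AB_gt0 : 0 < A - B by rewrite subr_gt0.
have k1 : 1 <= k%:R :> R by rewrite ler1n.
have k0 : 0 < k%:R :> R by rewrite ltr0n.
(* Since k >= 1, this is at least A - B. It is the factor governing the sign of the leading
   coefficient of [H1]. *)
have AkB : 0 < 2 * A * k%:R - A - B by nra.
have AkB' : 0 < A * k%:R + B by rewrite ltr_wpDr // mulr_gt0.
rewrite /Hpolys; move: (coef_a _ _ _ _) a_gt0 => a a_gt0.
rewrite !inE => /orP[/eqP->|].
  by rewrite lead_coef_quadratic_gt0 // !mulr_gt0.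
by move=> /or4P[| | |/or4P[]] /eqP ->;
  rewrite ?lead_coef_quartic_gt0 ?lead_coef_quadratic_gt0 //
    !(mulr_gt0, exprn_gt0).
Qed.

Lemma Lbound_spec : 1 <= Lbound A B k y1 y2 y3 y4 /\
  forall p (l : int), p \in Hpolys A B k y1 y2 y3 y4 ->
    Lbound A B k y1 y2 y3 y4 <= l -> 0 <= p.[l%:~R].
Proof.
have [L1 Lge0] := max_root_ge0 Hpolys_lead_gt0; rewrite /Lbound; split.
  by rewrite -gtz0_ge1 ceil_gt0 (lt_le_trans ltr01).
by move=> p l pH; rewrite ceil_le_int => /(Lge0 _ _ pH).
Qed.

End Hpolys.

(** * Lower bounds on blocks *)

Definition horner_expandE := (hornerD, hornerZ, hornerXn, hornerX, hornerC).

Section ThetaBlocks.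
Variables (R : realType) (A B k a b c e : R).
Implicit Types (x n l : R).

Definition quad x : R := A * x ^+ 2 + B * x.
Definition cubic x : R := a * x ^+ 3 + b * x ^+ 2 + c * x.

Definition block (u : R -> R) n x : R :=
  u (n - quad x) - u (n - quad (- x - 1)) - u (n - quad (x + 1)) +
  u (n - quad (- x - 2)).

(* [S1], [S2], [S3] are the signed sums of the exponents of the first [l]
   blocks, of their squares and of their cubes; the signs add up to 0, so the
   cubic terms in [n] cancel. *)
Definition block_sum n l : R :=
  let S1 := 2 * (A - B) * l in
  let S2 := 2 * (A - B) * l *
    (6 * A * k ^+ 2 + 12 * A * k * l + 8 * A * l ^+ 2 - A - B) in
  let S3 :=
    (30 * A ^+ 3 * k ^+ 4 - 30 * A ^+ 3 * k ^+ 2 + 6 * A ^+ 3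
     - 30 * A ^+ 2 * B * k ^+ 4 + 36 * A * B ^+ 2 * k ^+ 2 - 6 * A * B ^+ 2
     - 6 * B ^+ 3 * k ^+ 2) * l +
    (120 * A ^+ 3 * k ^+ 3 - 60 * A ^+ 3 * k - 120 * A ^+ 2 * B * k ^+ 3
     + 72 * A * B ^+ 2 * k - 12 * B ^+ 3 * k) * l ^+ 2 +
    (240 * A ^+ 3 * k ^+ 2 - 40 * A ^+ 3 - 240 * A ^+ 2 * B * k ^+ 2
     + 48 * A * B ^+ 2 - 8 * B ^+ 3) * l ^+ 3 +
    240 * A ^+ 2 * (A - B) * k * l ^+ 4 + 96 * A ^+ 2 * (A - B) * l ^+ 5 in
  a * (3 * n * S2 - 3 * n ^+ 2 * S1 - S3) + b * (S2 - 2 * n * S1) - c * S1.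

Lemma sum_block n (l : nat) :
  \sum_(i < l) block cubic n (k + 2 * i%:R) = block_sum n l%:R.
Proof.
elim: l => [|l IHl]; first by rewrite big_ord0 /block_sum; ring.
rewrite big_ord_recr /= IHl -(natr1 l) /block /block_sum /cubic /quad; ring.
Qed.

Hypotheses (a_gt0 : 0 < a) (ltBA : B < A).

(* H1 is the minimum over [n] of the derivative of the right-hand side, and H2
   its value at the left endpoint, minus the error. *)
Lemma block_case1 n l : quad (k + 2 * l) <= n ->
  0 <= (H1 A B k a b c e).[l] -> 0 <= (H2 A B k a b c e).[l] ->
  (4 * l + 1) * e <= block_sum n l + cubic (n - quad (k + 2 * l)).
Proof.
set m := n - quad _ => n_ge h1 h2; have m_ge0 : 0 <= m by rewrite subr_ge0.
(* [be] is the coefficient of m^2 in the difference [E] below, a cubic in m; completing squares in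
   (E - H2) / m isolates [H1]. *)
pose be := b - 6 * a * (A - B) * l.
have a_neq0 : a != 0 by rewrite gt_eqF.
rewrite -subr_ge0; set E := _ - _.
have -> : E = (H2 A B k a b c e).[l] + m * ((H1 A B k a b c e).[l] +
    ((be + 3 / 2 * a * m) ^+ 2 + 3 / 4 * a ^+ 2 * m ^+ 2) / (3 * a)).
  rewrite /E /be /m /H1 /H2 !horner_expandE /block_sum /cubic /quad.
  field.
  by rewrite a_neq0.
rewrite addr_ge0 // mulr_ge0 // addr_ge0 // divr_ge0 //; last first.
  by rewrite mulr_ge0 // ltW.
by rewrite addr_ge0 ?sqr_ge0 // !mulr_ge0 ?invr_ge0 // ltW.
Qed.

(* The right-hand side is the convex quadratic p n^2 + q n + r, whose minimum is
   r - q^2 / (4 p). *)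
Lemma block_case2 n l : 0 < 2 * k + 2 * l + 1 ->
  0 <= (H3 A B k a b c e).[l] ->
  (4 * l + 2) * e <= block_sum n l + cubic (n - quad (k + 2 * l)) -
    cubic (n - quad (- (k + 2 * l) - 1)).
Proof.
move=> kl h3; pose p := 3 * a * (A - B) * (2 * k + 2 * l + 1).
have AB : 0 < A - B by rewrite subr_gt0.
have p_gt0 : 0 < p by rewrite !mulr_gt0.
have a_neq0 : a != 0 by rewrite gt_eqF.
pose q := - 3 * a * (16 * A * (A - B) * l ^+ 3 +
    24 * A * (A - B) * (k + 1) * l ^+ 2 +
    (12 * A ^+ 2 * k ^+ 2 + 24 * A ^+ 2 * k + 10 * A ^+ 2 - 12 * A * B * k ^+ 2
     - 24 * A * B * k - 12 * A * B + 2 * B ^+ 2) * l +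
    4 * A ^+ 2 * k ^+ 3 + 6 * A ^+ 2 * k ^+ 2 + 4 * A ^+ 2 * k + A ^+ 2
     - 4 * A * B * k ^+ 3 - 6 * A * B * k ^+ 2 - 6 * A * B * k - 2 * A * B
     + 2 * B ^+ 2 * k + B ^+ 2) + 2 * b * (A - B) * (2 * l + 2 * k + 1).
rewrite -subr_ge0; set E := _ - _.
have -> : E = (H3 A B k a b c e).[l] + (2 * p * n + q) ^+ 2 / (4 * p).
  rewrite /E /p /q /H3 !horner_expandE /block_sum /cubic /quad.
  field.
  by rewrite a_neq0 !gt_eqF.
by rewrite addr_ge0 // divr_ge0 ?sqr_ge0 ?mulr_ge0 ?ltW.
Qed.

(* The derivative of the right-hand side is a concave quadratic in [n], with the
   values H4 and H5 at the endpoints; so the minimum is at the left endpoint. *)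
Lemma block_case3 n l : quad (k + 2 * l + 1) <= n <= quad (- (k + 2 * l) - 2) ->
  0 <= (H4 A B k a b c e).[l] -> 0 <= (H5 A B k a b c e).[l] ->
  0 <= (H6 A B k a b c e).[l] ->
  (4 * l + 3) * e <= block_sum n l + cubic (n - quad (k + 2 * l)) -
    cubic (n - quad (- (k + 2 * l) - 1)) - cubic (n - quad (k + 2 * l + 1)).
Proof.
case/andP=> le_un le_nv h4 h5 h6; set u := quad (k + 2 * l + 1) in le_un *.
set v := quad (- (k + 2 * l) - 2) in le_nv.
pose m := n - u; pose w := v - u.
pose s := 3 * a * (A - B) * (2 * k + 2 * l + 1) - b.
have m_ge0 : 0 <= m by rewrite subr_ge0.
have le_mw : m <= w by rewrite lerD2r.
have h5E : (H5 A B k a b c e).[l] =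
    (H4 A B k a b c e).[l] + 2 * s * w - 3 * a * w ^+ 2.
  by rewrite /H4 /H5 !horner_expandE /s /w /v /u /quad; ring.
rewrite -subr_ge0; set E := _ - _.
have -> : E = (H6 A B k a b c e).[l] +
    m * ((H4 A B k a b c e).[l] + s * m - a * m ^+ 2).
  rewrite /E /H4 /H6 !horner_expandE /s /m /u /block_sum /cubic /quad.
  by ring.
rewrite h5E in h5; move: h4 h5; set d := (H4 _ _ _ _ _ _ _).[l] => h4 h5.
rewrite addr_ge0 // mulr_ge0 //.
have [w_le0|w_gt0] := leP w 0.
  have -> : m = 0 by apply/eqP; rewrite eq_le m_ge0 (le_trans le_mw).
  by rewrite mulr0 expr0n /= mulr0 subr0 addr0.
(* Averaging [h4] and [h5] gives d + s w - (3/2) a w^2 >= 0, which is stronger. *)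
have dw : 0 <= d + s * w - a * w ^+ 2.
  have : 0 <= a * w ^+ 2 by rewrite mulr_ge0 ?sqr_ge0 // ltW.
  by move: h4 h5; lra.
rewrite -(pmulr_rge0 _ w_gt0).
(* Concavity in m: interpolation between the values at 0 and [w], plus a nonnegative remainder. *)
have -> : w * (d + s * m - a * m ^+ 2) =
  (w - m) * d + m * (d + s * w - a * w ^+ 2) + a * m * w * (w - m) by ring.
have wm : 0 <= w - m by rewrite subr_ge0.
by rewrite !addr_ge0 // !mulr_ge0 // ltW.
Qed.

(* The right-hand side is concave in [n]. *)
Lemma block_case4 n l : 0 <= l + 1 ->
  quad (- (k + 2 * l) - 2) <= n < quad (k + 2 * l + 2) ->
  0 <= (H7 A B k a b c e).[l] -> 0 <= (H8 A B k a b c e).[l] ->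
  (4 * l + 4) * e <= block_sum n l + block cubic n (k + 2 * l).
Proof.
move=> l_ge0 /andP[le_un lt_nv] h7 h8; set u := quad _ in le_un.
set v := quad (k + 2 * l + 2) in lt_nv.
have vu : 0 < v - u by rewrite subr_gt0 (le_lt_trans le_un).
rewrite -subr_ge0 -(pmulr_rge0 _ vu) /block.
set E := _ * _.
(* Linear interpolation between the endpoint values [H7] and [H8]; the last term is the concavity
   remainder, the coefficient of n^2 being -6a(A-B)(l+1). *)
have -> : E = (v - n) * (H7 A B k a b c e).[l] + (n - u) *
    (H8 A B k a b c e).[l] +
    6 * a * (A - B) * (l + 1) * (n - u) * (v - n) * (v - u).
  by rewrite /E /H7 /H8 !horner_expandE /u /v /block_sum /cubic /quad; ring.
have vn : 0 <= v - n by rewrite subr_ge0 ltW.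
have nu : 0 <= n - u by rewrite subr_ge0.
have AB : 0 <= A - B by rewrite subr_ge0 ltW.
by rewrite !addr_ge0 // !mulr_ge0 // ltW.
Qed.

End ThetaBlocks.

(** * The coefficients as sums of blocks *)

Section Exponents.
Variables (R : realType) (A B : R).
Hypotheses (hAB : integer_valued A B) (B_ge0 : 0 <= B) (ltBA : B < A).
Local Notation Q := (quad A B).

Lemma quad_nat (j : int) : Q j%:~R \is a Num.nat.
Proof.
have A_ge0 : 0 <= A by rewrite (le_trans B_ge0) ?ltW.
rewrite natrEint hAB /= /quad.
have [j_ge0|j_lt0] := leP 0 j.
  by rewrite addr_ge0 ?mulr_ge0 ?sqr_ge0 ?ler0z.
have j1 : j%:~R <= - 1 :> R by rewrite -[-1 : R]/((-1)%:~R) ler_int; lia.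
(* For j <= -1 both j^2 and j(j+1) are nonnegative. *)
have -> : A * j%:~R ^+ 2 + B * j%:~R =
  (A - B) * j%:~R ^+ 2 + B * (j%:~R * (j%:~R + 1)) by ring.
rewrite addr_ge0 //; first by rewrite mulr_ge0 ?sqr_ge0 ?subr_ge0 ?(ltW ltBA).
by rewrite mulr_ge0 // mulr_le0 // -?lerBrDr ?sub0r // (le_trans j1) ?oppr_le0.
Qed.

Lemma quad_mono x y : 0 <= x -> x <= y -> Q x <= Q y.
Proof.
move=> x_ge0 xy; rewrite /quad lerD ?ler_wpM2l //; last first.
  by rewrite lerXn2r ?nnegrE // (le_trans x_ge0).
by rewrite (le_trans B_ge0) ?ltW.
Qed.

Lemma quad_neg_ge x : 0 <= x -> Q x <= Q (- x - 1).
Proof.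
move=> x_ge0; rewrite -subr_ge0.
have -> : Q (- x - 1) - Q x = (A - B) * (2 * x + 1) by rewrite /quad; ring.
by rewrite mulr_ge0 ?subr_ge0 ?(ltW ltBA) // addr_ge0 // mulr_ge0.
Qed.

Lemma quad_neg_le x : 0 <= x -> Q (- x) <= Q x.
Proof.
move=> x_ge0; rewrite -subr_ge0.
have -> : Q x - Q (- x) = 2 * (B * x) by rewrite /quad; ring.
by rewrite !mulr_ge0.
Qed.

End Exponents.

Section GammaBlocks.
Variables (R : realType) (A B : R).
Hypotheses (hAB : integer_valued A B) (B_ge0 : 0 <= B) (ltBA : B < A).
Local Notation Q := (quad A B).

(* The sequence [p] extended by 0 to the negative reals, so that the terms
   with exponent above [n] need no separate treatment. *)
Definition extend (p : fps R) (x : R) : R :=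
  if 0 <= x then p (Num.truncn x) else 0.

Definition tail_indices (k M : nat) : seq int :=
  [seq (k + i)%:Z | i <- iota 0 M] ++ [seq - (k + i)%:Z - 1 | i <- iota 0 M].

Lemma tail_indices_uniq k M : uniq (tail_indices k M).
Proof.
rewrite cat_uniq !map_inj_uniq ?iota_uniq ?andbT /=.
- by apply/hasPn => _ /mapP[i _ ->]; apply/negP => /mapP[j _]; lia.
- by move=> i j; lia.
- by move=> i j; lia.
Qed.

Lemma mem_tail_indices k M (j : int) :
  (j \in tail_indices k M) =
  ((k%:Z <= j) && (j < (k + M)%:Z)) ||
  ((j < - k%:Z) && (- (k + M)%:Z <= j)).
Proof.
apply/idP/idP.
  rewrite mem_cat => /orP[] /mapP[i]; rewrite mem_iota => /andP[_ iM] ->; lia.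
rewrite mem_cat => /orP[/andP[kj jM]|/andP[jk Mj]]; apply/orP; [left|right].
  by apply/mapP; exists (absz j - k)%N; rewrite ?mem_iota; lia.
by apply/mapP; exists (absz (j + 1)%R - k)%N; rewrite ?mem_iota; lia.
Qed.

(** Indices outside the list have exponent at least [Q (k + M)], by monotonicity and, for negative
    ones, the reflection j -> -j-1. *)
Lemma theta_tailE k M m : m%:R < Q (k + M)%:R ->
  theta_tail A B k m =
  \sum_(j <- tail_indices k M | Q j%:~R == m%:R) (-1) ^ (j + k%:Z).
Proof.
move=> mM; rewrite /theta_tail -[RHS]big_filter.
rewrite [RHS]fsbig_seq ?filter_uniq ?tail_indices_uniq //.
apply: eq_fsbigl; apply/seteqP; split=> j; rewrite /= mem_filter.
  move=> [kj Qj]; rewrite {1}/quad Qj eqxx /= mem_tail_indices.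
  have Qlt : Q j%:~R < Q (k + M)%:R by rewrite /quad Qj.
  have [jlo|jhi] : (j < - k%:Z) \/ (k%:Z <= j) by lia.
    suff : - (k + M)%:Z <= j by lia.
    rewrite leNgt; apply/negP => jM; move: Qlt; apply/negP; rewrite -leNgt.
    have -> : j%:~R = - (- j - 1)%:~R - 1 :> R by rewrite rmorphB rmorphN; ring.
    have M0 : (k + M)%:R <= (- j - 1)%:~R :> R.
      by rewrite -[(k + M)%:R]/((k + M)%:Z%:~R) ler_int; lia.
    apply: le_trans (quad_neg_ge ltBA (le_trans (ler0n _ _) M0)).
    exact: quad_mono.
  suff : j < (k + M)%:Z by lia.
  rewrite ltNge; apply/negP => jM; move: Qlt; apply/negP; rewrite -leNgt.
  by rewrite quad_mono // -[(k + M)%:R]/((k + M)%:Z%:~R) ler_int.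
rewrite mem_tail_indices => /andP[/eqP Qj jJ]; split=> //.
by move: jJ; lia.
Qed.

(** [Q j] is a natural number q, so only i = n - q contributes, and only when q <= n. *)
Lemma extendE (p : fps R) n (j : int) :
  \sum_(i < n.+1 | Q j%:~R == (n - i)%N%:R) p i = extend p (n%:R - Q j%:~R).
Proof.
have [q ->] := natrP (quad_nat hAB B_ge0 ltBA j).
rewrite /extend subr_ge0 ler_nat.
case: leqP => [qn|nq].
  have nq1 : (n - q < n.+1)%N by rewrite ltnS leq_subr.
  rewrite -natrB // natrK (big_pred1 (Ordinal nq1)) // => i.
  rewrite eqr_nat -[RHS]val_eqE /=; have := ltn_ord i; lia.
by rewrite big1 // => i; rewrite eqr_nat; lia.
Qed.

Lemma gamma_sum (S : seq nat) k M n : n%:R < Q (k + M)%:R ->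
  gamma S A B k n = \sum_(j <- tail_indices k M)
    (-1) ^ (j + k%:Z) * extend (inv_prod R S) (n%:R - Q j%:~R).
Proof.
move=> nM; rewrite /gamma /fps_mul.
under eq_bigr => i _.
  rewrite (@theta_tailE _ M); last first.
    by apply: le_lt_trans nM; rewrite ler_nat leq_subr.
  rewrite mulr_sumr big_mkcond /=; over.
rewrite exchange_big /=; apply: eq_bigr => j _.
rewrite -extendE mulr_sumr [RHS]big_mkcond /=; apply: eq_bigr => i _.
by case: ifP; rewrite // mulrC.
Qed.

(** The indices j and -j-1 carry opposite signs, and these alternate with j: the pairs from j = x
    and j = x + 1 form one block. *)
Lemma gamma_blocks (S : seq nat) k l n : n%:R < Q (k%:R + 2 * l.+1%:R) ->
  gamma S A B k n = \sum_(i < l.+1)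
    block A B (extend (inv_prod R S)) n%:R (k%:R + 2 * i%:R).
Proof.
move=> nl; set u := extend _.
rewrite (@gamma_sum _ k (2 * l.+1)); last by rewrite natrD natrM.
transitivity (\sum_(i < 2 * l.+1) (-1) ^+ i *
    (u (n%:R - Q (k%:R + i%:R)) - u (n%:R - Q (- (k%:R + i%:R) - 1)))).
  rewrite /tail_indices big_cat !big_map -/u; move: (2 * l.+1)%N => M /=.
  rewrite -(big_mkord xpredT
    (fun i => (-1) ^+ i * (u (n%:R - Q (k%:R + i%:R)) -
      u (n%:R - Q (- (k%:R + i%:R) - 1))))).
  rewrite /index_iota subn0 -big_split /=; apply: eq_bigr => i _.
  have -> : (-1) ^ ((k + i)%:Z + k%:Z) = (-1) ^+ i :> R.
    rewrite -PoszD -exprnP addnAC exprD addnn -mul2n exprM.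
    by rewrite sqrrN !expr1n mul1r.
  have -> : (-1) ^ (- (k + i)%:Z - 1 + k%:Z) = - (-1) ^+ i :> R.
    have -> : - (k + i)%:Z - 1 + k%:Z = Negz i by rewrite NegzE; lia.
    by rewrite /exprz /= invr_sign exprS mulN1r.
  by rewrite mulrBr mulNr rmorphB rmorphN /= -!pmulrn natrD.
elim: l.+1 => [|t IHt]; first by rewrite muln0 !big_ord0.
rewrite mulnS addnC !addnS addn0 !big_ord_recr /= IHt -addrA; congr (_ + _).
rewrite exprS exprM sqrrN !expr1n /block -(natr1 (2 * t)%N) natrM.
have -> : k%:R + (2 * t%:R + 1) = k%:R + 2 * t%:R + 1 :> R by ring.
have -> : - (k%:R + 2 * t%:R + 1) - 1 = - (k%:R + 2 * t%:R) - 2 :> R by ring.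
by ring.
Qed.

End GammaBlocks.

(** * Nonnegativity for n between two consecutive block starts *)

Section MainEstimate.
Variables (R : realType) (A B : R) (k : nat) (a b c e : R).
Hypotheses (B_ge0 : 0 <= B) (ltBA : B < A) (a_gt0 : 0 < a).
Local Notation Q := (quad A B).
Local Notation f := (cubic a b c).
Variables (u : R -> R) (n : R) (l : nat).
Hypothesis u_neg : forall x, x < 0 -> u x = 0.
Hypothesis u_cubic : forall j : int, Q j%:~R <= n ->
  `|u (n - Q j%:~R) - f (n - Q j%:~R)| <= e.
Local Notation x i := (k%:R + 2 * i%:R : R).
Hypothesis n_range : Q (x l) <= n < Q (x l + 2).
Hypothesis H_ge0 : forall p, p \in
  [:: H1 A B k%:R a b c e; H2 A B k%:R a b c e; H3 A B k%:R a b c e;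
      H4 A B k%:R a b c e; H5 A B k%:R a b c e; H6 A B k%:R a b c e;
      H7 A B k%:R a b c e; H8 A B k%:R a b c e] -> 0 <= p.[l%:R].

Lemma x_ge0 i : 0 <= x i.
Proof. by rewrite addr_ge0 // mulr_ge0. Qed.

Lemma quad_sorted i : [/\ Q (x i) <= Q (- x i - 1),
  Q (- x i - 1) <= Q (x i + 1), Q (x i + 1) <= Q (- x i - 2) &
  Q (- x i - 2) <= Q (x i + 2)].
Proof.
have xi := x_ge0 i; have xi1 : 0 <= x i + 1 by rewrite addr_ge0.
have xi2 : 0 <= x i + 2 by rewrite addr_ge0.
split; first exact: quad_neg_ge.
- by rewrite -opprD; exact: quad_neg_le.
- have -> : - x i - 2 = - (x i + 1) - 1 by ring.
  exact: quad_neg_ge.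
- by rewrite -opprD; exact: quad_neg_le.
Qed.

Lemma u_near (j : int) y : y = j%:~R -> Q y <= n ->
  f (n - Q y) - e <= u (n - Q y) <= f (n - Q y) + e.
Proof. by move=> -> /u_cubic; rewrite ler_norml; lra. Qed.

Lemma u_near_x i : [/\
  Q (x i) <= n -> f (n - Q (x i)) - e <= u (n - Q (x i)),
  Q (- x i - 1) <= n -> u (n - Q (- x i - 1)) <= f (n - Q (- x i - 1)) + e,
  Q (x i + 1) <= n -> u (n - Q (x i + 1)) <= f (n - Q (x i + 1)) + e &
  Q (- x i - 2) <= n -> f (n - Q (- x i - 2)) - e <= u (n - Q (- x i - 2))].
Proof.
have xE : x i = (k%:Z + 2 * i%:Z)%:~R by rewrite rmorphD rmorphM.
split.
- by move/(u_near xE)/andP => [].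
- have E : - x i - 1 = (- (k%:Z + 2 * i%:Z) - 1)%:~R
    by rewrite xE rmorphB rmorphN.
  by move/(u_near E)/andP => [].
- have E : x i + 1 = (k%:Z + 2 * i%:Z + 1)%:~R by rewrite xE [RHS]rmorphD.
  by move/(u_near E)/andP => [].
- have E : - x i - 2 = (- (k%:Z + 2 * i%:Z) - 2)%:~R
    by rewrite xE rmorphB rmorphN.
  by move/(u_near E)/andP => [].
Qed.

(** All four exponents of an earlier block are at most [n], so each of its terms is within [e] of
    the cubic. *)
Lemma full_blocks_ge : block_sum A B k%:R a b c n l%:R - 4 * l%:R * e <=
  \sum_(i < l) block A B u n (x i).
Proof.
rewrite -sum_block.
have -> : 4 * l%:R * e = \sum_(i < l) 4 * e :> R.
  by rewrite sumr_const card_ord -mulr_natr; ring.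
rewrite -sumrB ler_sum // => i _.
have [q1 q2 q3 q4] := quad_sorted i; have [u1 u2 u3 u4] := u_near_x i.
have q5 : Q (x i + 2) <= n.
  have /andP[+ _] := n_range; apply: le_trans.
  apply: quad_mono => //; first by rewrite addr_ge0 ?x_ge0.
  rewrite -addrA lerD2l.
  by rewrite -[X in _ + X]mulr1 -mulrDr ler_pM2l // natr1 ler_nat.
by rewrite /block; move: u1 u2 u3 u4; lra.
Qed.

(** Cases on how many exponents of the last block are at most [n]: later terms vanish, and each
    remaining one adds [e] to the error of the full blocks. *)
Lemma sum_blocks_ge0 : 0 <= \sum_(i < l.+1) block A B u n (x i).
Proof.
rewrite big_ord_recr /=; move: full_blocks_ge; set G := \sum_(i < l) _ => GE.
have [q1 q2 q3 q4] := quad_sorted l; have [u1 u2 u3 u4] := u_near_x l.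
have /andP[n_ge n_lt] := n_range.
have h i : (i < 8)%N -> 0 <= ([:: H1 A B k%:R a b c e; H2 A B k%:R a b c e;
    H3 A B k%:R a b c e; H4 A B k%:R a b c e; H5 A B k%:R a b c e;
    H6 A B k%:R a b c e; H7 A B k%:R a b c e; H8 A B k%:R a b c e]`_i).[l%:R].
  by move=> i8; apply: H_ge0; exact: mem_nth.
have u0 y : n < Q y -> u (n - Q y) = 0 by move=> ny; rewrite u_neg // subr_lt0.
rewrite /block; have [n1|n1] := ltP n (Q (- x l - 1)).
  have := block_case1 a_gt0 n_ge (h 0%N isT) (h 1%N isT).
  by rewrite (u0 (- x l - 1)) // (u0 (x l + 1)) 1?(u0 (- x l - 2)); lra.
have [n2|n2] := ltP n (Q (x l + 1)).
  have := @block_case2 _ _ _ k%:R _ b c e a_gt0 ltBA n l%:R _ (h 2%N isT).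
  rewrite (u0 (x l + 1)) // (u0 (- x l - 2)); last by lra.
  have kl : 0 < 2 * k%:R + 2 * l%:R + 1 :> R.
    by rewrite ltr_wpDl // addr_ge0 ?mulr_ge0.
  by move/(_ kl); move: u1 u2; lra.
have [n3|n3] := ltP n (Q (- x l - 2)).
  have nn : Q (x l + 1) <= n <= Q (- x l - 2) by rewrite n2 ltW.
  have := block_case3 a_gt0 nn (h 3%N isT) (h 4%N isT) (h 5%N isT).
  rewrite (u0 (- x l - 2)) //.
  by move: u1 u2 u3; lra.
have nn : Q (- x l - 2) <= n < Q (x l + 2) by rewrite n3.
have := @block_case4 _ _ _ k%:R _ b c e a_gt0 ltBA n l%:R _ nn
  (h 6%N isT) (h 7%N isT).
have l1 : 0 <= l%:R + 1 :> R by rewrite addr_ge0.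
by move/(_ l1); rewrite /block; move: u1 u2 u3 u4; lra.
Qed.

End MainEstimate.

Lemma quad_bracket (R : realType) (A B : R) (k L n : nat) :
  0 <= B -> B < A -> quad A B (k%:R + 2 * L%:R) <= n%:R ->
  exists2 l : nat, (L <= l)%N &
    quad A B (k%:R + 2 * l%:R) <= n%:R < quad A B (k%:R + 2 * l%:R + 2).
Proof.
move=> B_ge0 ltBA nL; have A_gt0 : 0 < A by exact: le_lt_trans ltBA.
pose P l := quad A B (k%:R + 2 * l%:R) <= n%:R.
(* Q(k + 2l) >= A l bounds the admissible [l], so a greatest one exists. *)
have P_bound l : P l -> (l <= Num.truncn (n%:R / A))%N.
  move=> Pl; rewrite truncn_ge_nat ?divr_ge0 ?(ltW A_gt0) //.
  rewrite ler_pdivlMr //; apply: le_trans Pl; rewrite /quad.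
  have l_ge0 : 0 <= l%:R :> R by [].
  have k_ge0 : 0 <= k%:R :> R by [].
  have ll : l%:R <= l%:R ^+ 2 :> R.
    by rewrite -natrX ler_nat; case: (l) => // m; rewrite expnS leq_pmulr.
  rewrite mulrC; apply: (@le_trans _ _ (A * (k%:R + 2 * l%:R) ^+ 2)).
    by rewrite ler_pM2l //; nra.
  by rewrite lerDl mulr_ge0 // addr_ge0 ?mulr_ge0.
have [l Pl l_max] := ex_maxnP (ex_intro P L nL) P_bound.
exists l; first exact: l_max.
rewrite [_ <= _]Pl ltNge; apply/negP => Pl1.
have /l_max : P l.+1.
  by rewrite /P -(natr1 l) mulrDr mulr1 addrA.
by rewrite ltnn.
Qed.

Theorem theorem2p1 (R : realType) (A B : R) (k y1 y2 y3 y4 : nat)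
    (hAB : integer_valued A B) (hB : 0 <= B) (hBA : B < A) (hk : (1 <= k)%N)
    (hYpos : all (leq 1) [:: y1; y2; y3; y4])
    (hYuniq : uniq [:: y1; y2; y3; y4])
    (hYcop : pairwise coprime [:: y1; y2; y3; y4]) :
  forall n : nat, Nbound A B k y1 y2 y3 y4 <= n%:R ->
    0 <= gamma [:: y1; y2; y3; y4] A B k n.
Proof.
move=> n; have [L1 Hge0] := Lbound_spec hB hBA hk hYpos.
rewrite /Nbound; move: L1 Hge0; case: (Lbound A B k y1 y2 y3 y4) => // L _ Hge0.
move/(quad_bracket hB hBA) => [l Ll nl].
rewrite (@gamma_blocks _ _ _ hAB hB hBA _ _ l); last first.
  by have /andP[_] := nl; rewrite -(natr1 l) mulrDr mulr1 [k%:R + (_ + _)]addrA.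
apply: (sum_blocks_ge0 hB hBA (coef_a_gt0 R hYpos)
  (b := coef_b y1%:R y2%:R y3%:R y4%:R) (c := coef_c y1%:R y2%:R y3%:R y4%:R)
  (e := coef_D R y1 y2 y3 y4)) => //.
- by move=> x x_lt0; rewrite /extend leNgt x_lt0.
- move=> j jn; rewrite /extend subr_ge0 jn.
  (* At the natural number n - q, subtracting the cubic from [extend] leaves [periodic_part]. *)
  have [q Qq] := natrP (quad_nat hAB hB hBA j).
  rewrite Qq in jn *; rewrite -natrB -1?(ler_nat R) // natrK.
  exact: periodic_part_le.
- by move=> p pH; apply: (Hge0 p l) => //; rewrite lez_nat.
Qed.
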